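(* Let $\mathcal{C} = (S_{\mathcal C}, \Sigma_{\mathcal C}, \mathit{next}_{\mathcal C}, \mathit{leak}_{\mathcal C})$ and $\mathcal{H} = (S_{\mathcal H}, \Sigma_{\mathcal H}, \mathit{next}_{\mathcal H}, \mathit{leak}_{\mathcal H})$ be two transition systems. For all $s_1, s_2 \in S_{\mathcal C}$, $h_1, h_2 \in S_{\mathcal H}$ and $R, R' \subseteq S_{\mathcal C} \times S_{\mathcal C} \times S_{\mathcal H} \times S_{\mathcal H}$, the following rules hold for the guarded quintuples $\mathsf{Grd}(R; s_1,s_2,h_1,h_2)$ and unguarded quintuples $\mathsf{Ungrd}(R; s_1,s_2,h_1,h_2)$: 1. (C-Leak) If $\mathit{leak}_{\mathcal C}(s_1) \neq \mathit{leak}_{\mathcal C}(s_2)$, then $\mathsf{Grd}(R; s_1, s_2, h_1, h_2)$. 2. (C-Step) If $\mathsf{Grd}(R; \mathit{next}_{\mathcal C}(s_1), \mathit{next}_{\mathcal C}(s_2), h_1, h_2)$, then $\mathsf{Grd}(R; s_1, s_2, h_1, h_2)$. 3. (H-Step) If $\mathit{leak}_{\mathcal H}(h_1) = \mathit{leak}_{\mathcal H}(h_2)$ and $\mathsf{Ungrd}(R; s_1, s_2, \mathit{next}_{\mathcal H}(h_1), \mathit{next}_{\mathcal H}(h_2))$, then $\mathsf{Grd}(R; s_1, s_2, h_1, h_2)$. 4. (Invariant) If $(s_1, s_2, h_1, h_2) \in R'$ and $\mathsf{Grd}(R \cup R'; s'_1, s'_2, h'_1, h'_2)$ holds for all $(s'_1,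 s'_2, h'_1, h'_2) \in R'$, then $\mathsf{Grd}(R; s_1, s_2, h_1, h_2)$. 5. (Cycle) If $(s_1, s_2, h_1, h_2) \in R$, then $\mathsf{Ungrd}(R; s_1, s_2, h_1, h_2)$. 6. (Guard) If $\mathsf{Grd}(R; s_1, s_2, h_1, h_2)$, then $\mathsf{Ungrd}(R; s_1, s_2, h_1, h_2)$.
   Context: A transition system is a tuple $\mathcal T = (S, \Sigma, \mathit{next}, \mathit{leak})$, where $S$ is a set of states, $\Sigma$ is a set of observations, $\mathit{next} : S \to S$ is a transition function and $\mathit{leak} : S \to \Sigma$ is a leakage function. For a monotone function $F$ on the powerset of a set, $\nu X.\,F(X)$ denotes its greatest fixpoint and $\mu X.\,F(X)$ its least fixpoint. For $R_1 \subseteq S_{\mathcal C} \times S_{\mathcal C} \times S_{\mathcal H} \times S_{\mathcal H}$ define $\mathtt{rbisimF}(R_1) = \mu R_2.\, \Psi(R_1,R_2)$, where $\Psi(R_1, R_2)$ is the union of the three sets $\{ (s_1, s_2, h_1, h_2) \mid \mathit{leak}_{\mathcal C}(s_1) \neq \mathit{leak}_{\mathcal C}(s_2) \}$, $\{ (s_1, s_2, h_1, h_2) \mid (\mathit{next}_{\mathcal C}(s_1), \mathit{next}_{\mathcal C}(s_2), h_1, h_2) \in R_2 \}$, $\{ (s_1, s_2, h_1, h_2) \mid \mathit{leak}_{\mathcal H}(h_1) = \mathit{leak}_{\mathcal H}(h_2) \wedge (s_1, s_2, \mathit{next}_{\mathcal H}(h_1), \mathit{next}_{\mathcal H}(h_2))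 \in R_1 \}$. Let $F = \mathtt{rbisimF}$ and, for $R \subseteq S_{\mathcal C} \times S_{\mathcal C} \times S_{\mathcal H} \times S_{\mathcal H}$, let $G_F(R) = \nu X.\, F(X \cup R)$. The proof quintuples are defined by $$\mathsf{Grd}(R; s_1,s_2,h_1,h_2) :\iff (s_1, s_2, h_1, h_2) \in G_F(R), \qquad \mathsf{Ungrd}(R; s_1,s_2,h_1,h_2) :\iff (s_1, s_2, h_1, h_2) \in R \cup G_F(R).$$ (The paper writes the first with a solid box around $R$ and the second with a dashed box around $R$.) *)

(* Defs.v *)
From mathcomp Require Import all_boot all_classical.

Set Implicit Arguments.
Unset Strict Implicit.
Unset Printing Implicit Defensive.

Local Open Scope classical_set_scope.

Section Fixpoints.
Variable T : Type.
Implicit Types (F : set T -> set T) (X Y : set T).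

Definition greatest_fixpoint F X :=
  F X = X /\ forall Y, F Y = Y -> Y `<=` X.

Definition least_fixpoint F X :=
  F X = X /\ forall Y, F Y = Y -> X `<=` Y.

(* Definite descriptions: the value set0 is only used when there is no such
   fixpoint, which nuP and muP exclude for monotone F. *)
Definition nu F : set T := xget set0 (greatest_fixpoint F).
Definition mu F : set T := xget set0 (least_fixpoint F).

Definition Gfix F (R : set T) : set T := nu (fun X => F (X `|` R)).

Lemma greatest_fixpoint_bigcup F : {homo F : X Y / X `<=` Y} ->
  greatest_fixpoint F (\bigcup_(X in [set X | X `<=` F X]) X).
Proof.
move=> Fmono; set G := \bigcup_(_ in _) _.
have GF : G `<=` F G.
  move=> x [X XF Xx]; apply: (Fmono X G); last exact: XF.
  by move=> y Xy; exists X.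
split; last by move=> Y FY y Yy; exists Y; rewrite //= FY.
apply/seteqP; split=> // x FGx; exists (F G) => //=.
exact: Fmono.
Qed.

Lemma least_fixpoint_bigcap F : {homo F : X Y / X `<=` Y} ->
  least_fixpoint F (\bigcap_(X in [set X | F X `<=` X]) X).
Proof.
move=> Fmono; set G := \bigcap_(_ in _) _.
have FG : F G `<=` G.
  move=> x FGx X FX; apply: (FX); apply: (Fmono G X) FGx => y; exact.
split; last by move=> Y FY y Gy; apply: Gy => /=; rewrite FY.
apply/seteqP; split=> // x Gx; apply: Gx => /=.
exact: Fmono.
Qed.

Lemma nuP F : {homo F : X Y / X `<=` Y} -> greatest_fixpoint F (nu F).
Proof. by move=> /greatest_fixpoint_bigcup /xgetI; apply. Qed.

Lemma muP F : {homo F : X Y / X `<=` Y} -> least_fixpoint F (mu F).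
Proof. by move=> /least_fixpoint_bigcap /xgetI; apply. Qed.

Lemma mu_ind F X :
  {homo F : Y Z / Y `<=` Z} -> F X `<=` X -> mu F `<=` X.
Proof.
move=> Fmono FX x; have [_ minF] := muP Fmono.
have [fixG _] := least_fixpoint_bigcap Fmono.
by move=> /(minF _ fixG) /(_ X FX).
Qed.

End Fixpoints.

Record transition_system := TransitionSystem {
  ts_state : Type;
  ts_obs : Type;
  ts_next : ts_state -> ts_state;
  ts_leak : ts_state -> ts_obs
}.

Section Rbisim.
Variables C H : transition_system.

Definition quad : Type := ts_state C * ts_state C * ts_state H * ts_state H.

Definition Psi (R1 R2 : set quad) : set quad :=
  [set x | let: (s1, s2, h1, h2) := x in ts_leak s1 <> ts_leak s2] `|`
  [set x | let: (s1, s2, h1, h2) := x in R2 (ts_next s1, ts_next s2, h1, h2)] `|`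
  [set x | let: (s1, s2, h1, h2) := x in
    ts_leak h1 = ts_leak h2 /\ R1 (s1, s2, ts_next h1, ts_next h2)].

Definition rbisimF (R1 : set quad) : set quad := mu (fun R2 => Psi R1 R2).

Lemma Psi_mono (R1 R1' R2 R2' : set quad) :
  R1 `<=` R1' -> R2 `<=` R2' -> Psi R1 R2 `<=` Psi R1' R2'.
Proof.
move=> sub1 sub2 [[[s1 s2] h1] h2] [[?|?]|[? ?]].
- by left; left.
- by left; right; apply: sub2.
- by right; split=> //; apply: sub1.
Qed.

Lemma rbisimF_mono : {homo rbisimF : R R' / R `<=` R'}.
Proof.
move=> R R' RR'.
have mono Q : {homo (fun R2 => Psi Q R2) : X Y / X `<=` Y}.
  by move=> X Y XY; apply: Psi_mono.
have [fixR' _] := muP (mono R'); rewrite -/(rbisimF R') in fixR'.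
apply: mu_ind => //; rewrite -[X in _ `<=` X]fixR'; exact: Psi_mono.
Qed.

Definition Grd (R : set quad) (s1 s2 : ts_state C) (h1 h2 : ts_state H) : Prop :=
  Gfix rbisimF R (s1, s2, h1, h2).

Definition Ungrd (R : set quad) (s1 s2 : ts_state C) (h1 h2 : ts_state H) : Prop :=
  (R `|` Gfix rbisimF R) (s1, s2, h1, h2).

End Rbisim.

(* Main.v *)
Require Import Defs.
From mathcomp Require Import all_boot all_classical.

Local Open Scope classical_set_scope.

(** Put [G = Gfix rbisimF R]. Unfolding the outer greatest and the inner least fixpoint once gives
    [Psi (G ∪ R) G = G] ([Grd_unfold]), and the three sets united in [Psi] are exactly C-Leak,
    C-Step and H-Step. Invariant is the accumulation principle of parameterized coinduction
    ([Gfix_absorb]); Cycle and Guard are the two halves of a union. *)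

Lemma nu_coind (T : Type) (F : set T -> set T) (Y : set T) :
  {homo F : X Z / X `<=` Z} -> Y `<=` F Y -> Y `<=` nu F.
Proof.
move=> Fmono YF x Yx; have [_ maxF] := nuP Fmono.
(* [maxF] bounds fixpoints only, so [Y] is first placed inside the union of all post-fixpoints,
   which is a fixpoint. *)
have [fixG _] := greatest_fixpoint_bigcup Fmono.
by apply: (maxF _ fixG); exists Y.
Qed.

Section ParametricCoinduction.
Variables (T : Type) (F : set T -> set T).
Hypothesis Fmono : {homo F : X Y / X `<=` Y}.

Let mono_setU (R : set T) : {homo (fun X => F (X `|` R)) : X Y / X `<=` Y}.
Proof. by move=> X Y XY; apply/Fmono/setSU. Qed.

Lemma Gfix_unfold (R : set T) : F (Gfix F R `|` R) = Gfix F R.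
Proof. by have [] := nuP (mono_setU R). Qed.

(** The coinduction runs on [Gfix F (R ∪ Y)] rather than on [Y]: since this set already contains
    [Y], its unfolding [F (Gfix F (R ∪ Y) ∪ R ∪ Y)] lies in [F (Gfix F (R ∪ Y) ∪ R)], which makes it
    a post-fixpoint for the parameter [R]. *)
Lemma Gfix_absorb (R Y : set T) :
  Y `<=` Gfix F (R `|` Y) -> Y `<=` Gfix F R.
Proof.
move=> YG; apply: (subset_trans YG); apply: nu_coind; first exact: mono_setU.
rewrite -[X in X `<=` _]Gfix_unfold; apply: Fmono.
move=> x [Gx|[Rx|Yx]]; [by left | by right | by left; apply: YG].
Qed.

End ParametricCoinduction.

Lemma rbisimF_unfold (C H : transition_system) (R : set (quad C H)) :
  Psi R (rbisimF R) = rbisimF R.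
Proof.
have mono : {homo (fun R2 => Psi R R2) : X Y / X `<=` Y}.
  by move=> X Y XY; apply: Psi_mono.
by have [] := muP mono.
Qed.

Lemma Grd_unfold (C H : transition_system) (R : set (quad C H)) :
  Psi (Gfix (@rbisimF C H) R `|` R) (Gfix (@rbisimF C H) R) =
  Gfix (@rbisimF C H) R.
Proof.
have GE := Gfix_unfold _ _ (@rbisimF_mono C H) R.
by rewrite -[X in Psi _ X]GE rbisimF_unfold.
Qed.

Theorem theorem15 (C H : transition_system)
    (s1 s2 : ts_state C) (h1 h2 : ts_state H) (R R' : set (quad C H)) :
  (* C-Leak *)
  (ts_leak s1 <> ts_leak s2 -> Grd R s1 s2 h1 h2) /\
  (* C-Step *)
  (Grd R (ts_next s1) (ts_next s2) h1 h2 -> Grd R s1 s2 h1 h2) /\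
  (* H-Step *)
  (ts_leak h1 = ts_leak h2 -> Ungrd R s1 s2 (ts_next h1) (ts_next h2) ->
   Grd R s1 s2 h1 h2) /\
  (* Invariant *)
  (R' (s1, s2, h1, h2) ->
   (forall (s1' s2' : ts_state C) (h1' h2' : ts_state H),
      R' (s1', s2', h1', h2') -> Grd (R `|` R') s1' s2' h1' h2') ->
   Grd R s1 s2 h1 h2) /\
  (* Cycle *)
  (R (s1, s2, h1, h2) -> Ungrd R s1 s2 h1 h2) /\
  (* Guard *)
  (Grd R s1 s2 h1 h2 -> Ungrd R s1 s2 h1 h2).
Proof.
split; [|split; [|split; [|split; [|split]]]].
- by move=> leakC; rewrite /Grd -Grd_unfold; left; left.
- by move=> stepC; rewrite /Grd -Grd_unfold; left; right.
- by move=> leakH stepH; rewrite /Grd -Grd_unfold; right; split=> //; rewrite setUC.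
- move=> R's inv; apply: (Gfix_absorb _ _ (@rbisimF_mono C H) R R') R's.
  by move=> [[[? ?] ?] ?]; apply: inv.
- by left.
- by right.
Qed.
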